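(* Let $A,B\subseteq N$ with $|A|=|B|=r$, and let $Z=D^TK^{-1}D$. Then $$\det Z[A,B]=\frac{1}{\tau_c(G)}\sum_{F\in\mathcal F_{r+1}}\chi_F(A)\,\chi_F(B)\,w(F).$$
   Context: Network. $G=(V,E)$ is a finite connected simple undirected graph; each edge $e$ has a conductance $c_e\in\mathbb R_{>0}$. The weighted Laplacian $L_c$ is the $V\times V$ matrix with $(L_c)_{uu}=\sum_{e\ni u}c_e$, $(L_c)_{uv}=-c_{uv}$ if $uv\in E$, and $0$ otherwise. A spanning forest $F$ of $G$ is an acyclic subgraph with vertex set $V$ (isolated vertices allowed); $w(F)=\prod_{e\in F}c_e$; $\mathcal F_m$ is the set of spanning forests with exactly $m$ connected components. $\tau_c(G)=\sum_T\prod_{e\in T}c_e$, the sum over spanning trees $T$ of $G$. Matrix conventions. $A[S,T]$ is the submatrix with rows $S$ and columns $T$ in inherited order; $A[:,T]$ keeps all rows; empty determinants equal $1$. Superports. The boundary $M\subseteq V$ is nonempty and partitioned into nonempty superports $M=A_1\sqcup\cdots\sqcup A_p$. Choose a root $r_a\in A_a$ for each $a$; $R=\{r_1,\dots,r_p\}$, $N=M\setminus R$, $q=|N|$, $N=(x_1,\dots,x_q)$ in a fixed order; $r(x)$ is the root of the superport containing $x$. Fix a ground root $g\in R$. $K=L_c[V\setminus\{g\},V\setminus\{g\}]$. In $\mathbb R^{V\setminus\{g\}}$ with standard basis $(e_v)$ and the convention $e_g=0$, let $D$ be the matrix whose columns are $d_x=e_x-e_{r(x)}$, $x\in N$, in the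 fixed order. Quotient-incidence determinants. For a spanning forest $F$ with $s\ge1$ components, let $C_0(F)$ be the component containing $g$ and order the others as $C_1(F),\dots,C_{s-1}(F)$. Let $Q_F$ be the $(s-1)\times(|V|-1)$ matrix with columns indexed by $V\setminus\{g\}$ and $(Q_F)_{a,v}=1$ if $v\in C_a(F)$, $0$ otherwise ($1\le a\le s-1$), and $B_F=Q_FD$. For $S\subseteq N$ with $|S|=s-1$, $\chi_F(S)=\det B_F[:,S]$, with $\chi_F(\varnothing)=1$ when $s=1$. *)

(* Defs.v *)
From mathcomp Require Import all_boot all_order all_algebra.

Set Implicit Arguments.
Unset Strict Implicit.
Unset Printing Implicit Defensive.

Import Order.TTheory GRing.Theory Num.Theory.
Local Open Scope ring_scope.

(* Graphs on a finite vertex type are given by their edge sets, edges being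
   2-element vertex sets; a spanning subgraph is a subset of the edge set. *)
Section Graphs.

Variable V : finType.
Implicit Types (E F : {set {set V}}) (g : V).

Definition simple_graph E : Prop := forall e, e \in E -> #|e| = 2%N.

Definition adj E : rel V := fun u v => [set u; v] \in E.

Definition connected E : bool := [forall u, forall v, connect (adj E) u v].

(* A repetition-free vertex sequence has length at most #|V|, so the bound on
   the length n of the cycle is harmless. *)
Definition acyclic F : bool :=
  [forall n : 'I_#|V|.+1, forall t : n.-tuple V,
     ~~ [&& (2 < n)%N, uniq t & cycle (adj F) t]].

Definition spanning_forest E F : bool := (F \subset E) && acyclic F.

Definition spanning_tree E F : bool :=
  [&& F \subset E, acyclic F & connected F].

Definition components F : {set {set V}} :=
  equivalence_partition (connect (adj F)) [set: V].

Definition forests E (m : nat) : {set {set {set V}}} :=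
  [set F | spanning_forest E F & #|components F| == m].

Definition nonground_components g F : {set {set V}} :=
  [set C in components F | g \notin C].

End Graphs.

Section Matrices.

Variable R : realFieldType.

Definition subsetmx m n (A : 'M[R]_(m, n)) (S : {set 'I_m}) (T : {set 'I_n}) :
    'M[R]_(#|S|, #|T|) :=
  mxsub (fun i => enum_val i) (fun j => enum_val j) A.

(* The determinant of a matrix whose two dimensions are equal, but not
   convertible; only meaningful when m = n. *)
Definition sqdet m n (A : 'M[R]_(m, n)) : R :=
  \det (conform_mx (0 : 'M[R]_m) A).

End Matrices.

Section Network.

Variables (R : realFieldType) (V : finType).
Variables (E : {set {set V}}) (c : {set V} -> R).

Definition weight (F : {set {set V}}) : R := \prod_(e in F) c e.

Definition tau : R := \sum_(T | spanning_tree E T) weight T.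

Definition laplacian_entry (u v : V) : R :=
  if u == v then \sum_(e in E | u \in e) c e
  else if [set u; v] \in E then - c [set u; v] else 0.

Definition laplacian : 'M[R]_#|V| :=
  \matrix_(i, j) laplacian_entry (enum_val i) (enum_val j).

Variable g : V.

Definition offground : {set 'I_#|V|} := [set~ enum_rank g].

Definition vertex (i : 'I_#|offground|) : V := enum_val (enum_val i).

Definition groundedK : 'M[R]_#|offground| :=
  subsetmx laplacian offground offground.

(* Since [vertex i] is never g, this gives e_g = 0. *)
Definition basis_vector (v : V) : 'cV[R]_#|offground| :=
  \col_i (vertex i == v)%:R.

(* P is the partition of the boundary into superports and rt X the root chosen
   in the superport X. *)
Variables (P : {set {set V}}) (rt : {set V} -> V).

Definition superport_roots : {set V} := [set rt X | X in P].

Definition root_of (x : V) : V := rt (pblock P x).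

(* xs lists the non-root boundary vertices in the fixed order. *)
Variables (q : nat) (xs : q.-tuple V).

Definition positions (S : {set V}) : {set 'I_q} := [set j | tnth xs j \in S].

Definition Dmx : 'M[R]_(#|offground|, q) :=
  \matrix_(i, j)
    (basis_vector (tnth xs j) - basis_vector (root_of (tnth xs j))) i 0.

Definition Zmx : 'M[R]_q := Dmx^T *m invmx groundedK *m Dmx.

(* Below, Cs lists the components of a forest that avoid g. *)
Definition Qmx (Cs : seq {set V}) : 'M[R]_(size Cs, #|offground|) :=
  \matrix_(a, i) (vertex i \in nth set0 Cs a)%:R.

Definition Bmx (Cs : seq {set V}) : 'M[R]_(size Cs, q) := Qmx Cs *m Dmx.

Definition chi (Cs : seq {set V}) (S : {set V}) : R :=
  sqdet (colsub (fun j : 'I_#|positions S| => enum_val j) (Bmx Cs)).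

End Network.

(* Main.v *)
Require Import Defs.
From mathcomp Require Import all_boot all_order all_algebra.
Import Order.TTheory GRing.Theory Num.Theory.
Local Open Scope ring_scope.

Set Implicit Arguments.
Unset Strict Implicit.
Unset Printing Implicit Defensive.

(* The column selections of D can be any matrices U, W with r columns.  The
   bordered determinant det [K, W; -U^T, 0] equals det K * det (U^T K^-1 W) when K
   is invertible, and it makes sense for every K.  We show, by induction on the
   edge set, that it equals the sum of w(F) det (Q_F U) det (Q_F W) over the
   spanning forests F with r + 1 components.  Adding an edge e = uv changes K by
   c_e b b^T with b = e_u - e_v, and the bordered determinant by c_e times the one
   for [b U], [b W].  On the forest side, det (Q_F [b U]) vanishes when u and v are
   connected in F and is otherwise, up to a sign depending only on F and e,
   det (Q_(F + e) U): these terms are the forests containing e.  The case r = 0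
   is the matrix-tree theorem det K = tau.
   The product det (Q_F U) det (Q_F W) is handled as det (U^T (Q_F^T Q_F) W), which
   does not depend on the ordering of the components. *)

(** * Components and acyclicity under adding an edge *)

Section Connectivity.

Variable V : finType.
Implicit Types (F : {set {set V}}) (u v x y : V).

Lemma adjC F : symmetric (adj F).
Proof. by move=> x y; rewrite /adj setUC. Qed.

Lemma connect_adjC F : connect_sym (adj F).
Proof. exact: (sym_connect_sym (adjC F)). Qed.

Lemma set2_eq x y u v :
  [set x; y] = [set u; v] -> (x = u /\ y = v) \/ (x = v /\ y = u).
Proof.
move=> h; have: (x \in [set u; v]) && (y \in [set u; v]).
  by rewrite -h !inE !eqxx orbT.
have: (u \in [set x; y]) && (v \in [set x; y]) by rewrite h !inE !eqxx orbT.
rewrite !inE => /andP[ux vx] /andP[/orP[]/eqP ex /orP[]/eqP ey]; subst; auto.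
  by left; split=> //; move: vx; rewrite orbb => /eqP.
by left; split=> //; move: ux; rewrite orbb => /eqP.
Qed.

Lemma adjU1 F u v x y :
  adj ([set u; v] |: F) x y =
  [|| (x == u) && (y == v), (x == v) && (y == u) | adj F x y].
Proof.
rewrite /adj in_setU1 orbA; congr (_ || _).
apply/eqP/orP => [/set2_eq[] [-> ->]|[/andP[/eqP-> /eqP->]//|/andP[/eqP-> /eqP->]]].
- by left; rewrite !eqxx.
- by right; rewrite !eqxx.
- by rewrite setUC.
Qed.

(** A path in the larger graph can be cut down to at most one crossing of the new edge: in the
    induction on the path, a second crossing leads back to the component it came from. *)
Lemma connectU1 F u v x y :
  connect (adj ([set u; v] |: F)) x y =
  [|| connect (adj F) x y, connect (adj F) x u && connect (adj F) v y
    | connect (adj F) x v && connect (adj F) u y].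
Proof.
set G := _ |: F; apply/idP/idP.
  case/connectP => p; elim: p x => [|z p IHp] x /=.
    by move=> _ ->; rewrite connect0.
  case/andP; rewrite adjU1 => xz zp /(IHp _ zp) {IHp zp}.
  case/or3P: xz => [/andP[/eqP-> /eqP->]|/andP[/eqP-> /eqP->]|/connect1 xz].
  - by rewrite !connect0 /= => /or3P[->|/andP[_ ->]|->]; rewrite ?orbT.
  - by rewrite !connect0 /= => /or3P[->|->|/andP[_ ->]]; rewrite ?orbT.
  - by rewrite !(same_connect (connect_adjC F) xz).
have sub : subrel (connect (adj F)) (connect (adj G)).
  apply: connect_sub => a b ab; apply: connect1.
  by rewrite /G adjU1 ab !orbT.
have uv : connect (adj G) u v by apply: connect1; rewrite /G adjU1 !eqxx.
case/or3P => [/sub//|/andP[/sub xu /sub vy]|/andP[/sub xv /sub uy]].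
  exact: (connect_trans xu (connect_trans uv vy)).
rewrite connect_adjC in uv.
exact: (connect_trans xv (connect_trans uv uy)).
Qed.

Lemma acyclicP F :
  reflect (forall t : seq V, (2 < size t)%N -> uniq t -> ~~ cycle (adj F) t)
          (acyclic F).
Proof.
apply: (iffP forallP) => [h t t2 ut|h n].
  have lt : (size t < #|V|.+1)%N by rewrite ltnS -(card_uniqP ut) max_card.
  move/forallP: (h (Ordinal lt)) => /(_ (in_tuple t)) /=.
  by rewrite t2 ut.
apply/forallP => t; apply/negP => /and3P[n2 ut].
by apply/negP; apply: h => //; rewrite size_tuple.
Qed.

Lemma acyclic_sub F (G : {set {set V}}) : F \subset G -> acyclic G -> acyclic F.
Proof.
move=> /subsetP FG /acyclicP h; apply/acyclicP => t t2 ut.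
by apply: contra (h t t2 ut); apply: sub_cycle => x y; apply: FG.
Qed.

(** A repetition-free path from [u] to [v] in [F], closed by the new edge, would be a cycle. It has
    at least three vertices because [u != v] and [[set u; v] \notin F]. *)
Lemma acyclicU1_connect F u v :
  u != v -> [set u; v] \notin F -> acyclic ([set u; v] |: F) ->
  ~~ connect (adj F) u v.
Proof.
move=> uv eF /acyclicP h; apply/negP => /connectP[p0 pth lst].
case/shortenP: pth lst => p pth up _ lst.
case: p => [|y [|z p]] in pth up lst.
- by rewrite lst eqxx in uv.
- by rewrite /= in lst; move: pth eF; rewrite /= andbT /adj lst => ->.
- have /negP := h [:: u, y, z & p] isT up; apply.
  rewrite /cycle rcons_path -lst adjU1 !eqxx /= orbT andbT.
  by apply: sub_path pth => a b ab; rewrite adjU1 ab !orbT.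
Qed.

(** If a cycle of the larger graph steps along the new edge, the rest of it joins [u] and [v] inside
    [F]; otherwise the whole cycle lies in [F]. Both are excluded. *)
Lemma acyclicU1 F u v :
  acyclic F -> ~~ connect (adj F) u v -> acyclic ([set u; v] |: F).
Proof.
move=> /acyclicP h uv; apply/acyclicP => t t2 ut; apply/negP => cyc.
have /negP := h t t2 ut; apply; apply: cycle_from_next => // x xt.
have := next_cycle cyc xt; rewrite adjU1 orbA => /orP[e|//].
suff xy : connect (adj F) x (next t x).
  case/orP: e => /andP[/eqP ex /eqP ey].
    by rewrite -ex -ey xy in uv.
  by rewrite -ex -ey connect_adjC xy in uv.
rewrite connect_adjC.
(* Rotate the cycle to start at [x], so that [next t x] becomes its second vertex [y]. *)
case: (rot_to xt) => i s rt.
rewrite -(next_rot i ut) in e *.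
rewrite -(rot_cycle i) in cyc; rewrite -(rot_uniq i) in ut.
rewrite -(size_rot i) in t2.
move: cyc ut t2 e; rewrite rt.
case: s {rt} => [|y s]; first by [].
rewrite /= eqxx => /andP[_]; rewrite rcons_path => /andP[ps lx].
rewrite inE negb_or => /andP[/andP[xy xs] /andP[ys us]].
rewrite !ltnS => s0 e.
have keep a b : (a != x) || (b != y) -> (a != y) || (b != x) ->
    adj ([set u; v] |: F) a b -> adj F a b.
  rewrite adjU1.
  case/orP: e => /andP[/eqP <- /eqP <-]; rewrite -!negb_and.
    by move=> /negPf-> /negPf->.
  by move=> /negPf-> /negPf->.
(* The path is the rest of the cycle, from [y] through [s] back to [x]. *)
apply/connectP; exists (rcons s x); last by rewrite last_rcons.
rewrite rcons_path; apply/andP; split.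
  apply: (@sub_in_path _ (predC1 x)) ps.
    by move=> a b; rewrite !inE => ax bx; apply: keep; rewrite ?ax // bx orbT.
  rewrite /= eq_sym xy /=; apply/allP => z zs /=.
  by apply: contraNneq xs => <-.
(* The cycle has length at least three, so [s] is nonempty and ends in a vertex other than [y]; the
   closing step is therefore not the new edge traversed backwards. *)
have lys : last y s != y.
  case: s s0 ys {ps lx xs us} => // z s _ ys.
  by apply: contraNneq ys => <-; rewrite /= mem_last.
have lxs : last y s != x.
  have := mem_last y s; rewrite inE => /orP[/eqP->|ls].
    by rewrite eq_sym.
  by apply: contraNneq xs => <-.
by apply: keep lx; rewrite ?lxs ?lys.
Qed.

(** * Components as sets, and their merging under a new edge *)

Definition component F x : {set V} := [set y | connect (adj F) x y].

Lemma componentsE F : components F = [set component F x | x in V].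
Proof.
apply/setP=> C; apply/imsetP/imsetP => -[x _ ->]; exists x => //;
by apply/setP=> y; rewrite !inE.
Qed.

Lemma component_eq F x y : (component F x == component F y) = connect (adj F) x y.
Proof.
apply/eqP/idP => [/setP/(_ y)|xy].
  by rewrite !inE connect0 => ->.
apply/setP=> z; rewrite !inE.
exact: (same_connect (connect_adjC F) xy).
Qed.

Lemma mem_component F x C : C \in components F -> x \in C -> C = component F x.
Proof.
rewrite componentsE => /imsetP[y _ ->]; rewrite inE => yx.
by apply/eqP; rewrite component_eq.
Qed.

Lemma componentsU1 F u v : ~~ connect (adj F) u v ->
  let X := components F :\ component F u :\ component F v in
  components ([set u; v] |: F) = (component F u :|: component F v) |: X.
Proof.
move=> uv X; set G := _ |: F.
have cG x : component G x =
    if connect (adj F) u x || connect (adj F) v x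
    then component F u :|: component F v else component F x.
  case: ifP => h; apply/setP => y; rewrite !inE connectU1.
    rewrite ![connect _ x _]connect_adjC [connect _ y x]connect_adjC.
    case/orP: h => h.
      have h' : connect (adj F) x u by rewrite connect_adjC.
      rewrite h -(same_connect (connect_adjC F) h).
      by case: (connect (adj F) v y); rewrite /= ?andbF ?andbT ?orbT ?orbF ?orbb // ;
         case: (connect (adj F) u y); rewrite ?andbT ?andbF ?orbT ?orbF.
    rewrite h -(same_connect (connect_adjC F) h).
    by case: (connect (adj F) v y); rewrite /= ?andbF ?andbT ?orbT ?orbF ?orbb // ;
       case: (connect (adj F) u y); rewrite ?andbT ?andbF ?orbT ?orbF.
  move/negbT: h; rewrite negb_or => /andP[/negPf ux /negPf vx].
  by rewrite ![connect _ x u]connect_adjC ![connect _ x v]connect_adjC ux vx orbF.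
apply/setP => C; rewrite componentsE in_setU1.
apply/imsetP/orP => [[x _ ->]|[/eqP->|]].
- rewrite cG; case: ifP => [_|/negbT]; first by left.
  rewrite negb_or => /andP[ux vx]; right.
  rewrite !inE eq_sym component_eq vx eq_sym component_eq ux /=.
  by rewrite componentsE imset_f.
- by exists u => //; rewrite cG connect0.
- rewrite !inE => /and3P[vC uC]; rewrite componentsE => /imsetP[x _ eC].
  exists x => //; rewrite cG ifF //.
  by apply/negbTE; rewrite negb_or -!component_eq ![component F _ == component F x]eq_sym -eC uC.
Qed.

End Connectivity.

(** * Bordered determinants *)

Section BorderedDeterminants.

Variable R : fieldType.

Definition bordered n r (K : 'M[R]_n) (U W : 'M[R]_(n, r)) : 'M_(n + r) :=
  block_mx K W (- U^T) 0.

(** Block LU factorisation. The minus sign in the lower border makes the Schur complement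
    [U^T *m invmx K *m W] appear with a plus sign. *)
Lemma det_bordered_unit n r (K : 'M[R]_n) (U W : 'M[R]_(n, r)) :
  K \in unitmx ->
  \det (bordered K U W) = \det K * \det (U^T *m invmx K *m W).
Proof.
move=> uK.
have -> : bordered K U W =
    block_mx 1%:M 0 (- U^T *m invmx K) 1%:M
      *m block_mx K W 0 (U^T *m invmx K *m W).
  by rewrite mulmx_block !mul1mx !mul0mx !addr0 mulmxKV // !mulNmx addNr.
by rewrite det_mulmx det_lblock det_ublock !det1 !mul1r.
Qed.

Lemma det_bordered_nocol n (K : 'M[R]_n) (U W : 'M[R]_(n, 0)) :
  \det (bordered K U W) = \det K.
Proof. by rewrite /bordered (thinmx0 W) det_lblock det_mx00 mulr1. Qed.

(** The matrix is [diag(W, U^T)] times [[0 1; -1 0]], and the latter is a product of three shears,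
    each of determinant one. *)
Lemma det_bordered0_square n (U W : 'M[R]_n) :
  \det (bordered 0 U W) = \det (U^T *m W).
Proof.
have -> : bordered 0 U W = block_mx W 0 0 U^T *m
    (block_mx 1%:M 1%:M 0 1%:M *m block_mx 1%:M 0 (- 1%:M) 1%:M
     *m block_mx 1%:M 1%:M 0 1%:M).
  rewrite !mulmx_block.
  by rewrite !(mul1mx, mulmx1, mul0mx, mulmx0, addr0, add0r, mulmxN, subrr, addNr).
by rewrite !det_mulmx !det_ublock !det_lblock !det1 !mulr1 mulrC.
Qed.

(** Each of the two block rows has rank at most [minn n r], and twice that is less than [n + r] when
    [n] and [r] differ. *)
Lemma det_bordered0_neq n r (U W : 'M[R]_(n, r)) :
  r != n -> \det (bordered 0 U W) = 0.
Proof.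
move=> rn; apply/eqP/negPn/negP => nz.
have : bordered 0 U W \in unitmx by rewrite unitmxE unitfE.
move/mxrank_unit; rewrite /bordered /block_mx -addsmxE.
have -> : row_mx 0 W = W *m row_mx (0 : 'M_(r, n)) 1%:M.
  by rewrite mul_mx_row mulmx0 mulmx1.
have -> : row_mx (- U^T) 0 = - U^T *m row_mx 1%:M (0 : 'M_(n, r)).
  by rewrite mul_mx_row mulmx0 mulmx1.
set X := W *m _; set Y := _ *m _ => rk.
have rX : (\rank X <= minn n r)%N.
  by rewrite (leq_trans (mxrankM_maxl _ _)) // leq_min rank_leq_row rank_leq_col.
have rY : (\rank Y <= minn n r)%N.
  rewrite (leq_trans (mxrankM_maxl _ _)) // leq_min.
  by rewrite rank_leq_row rank_leq_col.
have := leq_add rX rY.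
rewrite leqNgt (leq_trans _ (mxrank_adds_leqif X Y)) // rk.
case/orP: (leq_total n r) => le_nr.
  by rewrite (minn_idPl le_nr) ltn_add2l ltn_neqAle eq_sym rn.
by rewrite (minn_idPr le_nr) ltn_add2r ltn_neqAle rn.
Qed.

Lemma det_castmx_sq m n (e1 e2 : m = n) (A : 'M[R]_m) :
  \det (castmx (e1, e2) A) = \det A.
Proof. by subst n; rewrite (eq_axiomK e2) castmx_id. Qed.

(* Bordering X by b, -b^T and the corner s gives an affine function of s: its
   slope is [\det X], and its value at s = 1 is a Schur complement. *)
Lemma det_rank1_update n (X : 'M[R]_n) (y b : 'cV[R]_n) :
  \det (X + y *m b^T) = \det X + \det (block_mx X y (- b^T) 0).
Proof.
have -> : \det (X + y *m b^T) = \det (block_mx X y (- b^T) 1%:M).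
  have -> : block_mx X y (- b^T) 1%:M =
      block_mx 1%:M y 0 1%:M *m block_mx (X + y *m b^T) 0 (- b^T) 1%:M.
    rewrite mulmx_block !mul1mx !mul0mx !mulmx1 !mulmxN !add0r.
    by rewrite addrK.
  by rewrite det_mulmx det_lblock det_ublock !det1 !mulr1 mul1r.
have -> : \det X = \det (block_mx X y 0 (1%:M : 'M_1)).
  by rewrite det_ublock det1 mulr1.
(* Every row other than the last lies in the upper block, where the three matrices agree. *)
have liftE i : exists k, lift (rshift n (0 : 'I_1)) i = lshift 1 k.
  have := neq_lift (rshift n (0 : 'I_1)) i.
  case: (splitP (lift (rshift n 0) i)) => k ek.
    by exists k; apply: val_inj.
  by case/eqP; apply: val_inj; apply: etrans (esym ek); rewrite (ord1 k).
rewrite -[RHS]mul1r mulrDr.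
(* The last row [(-b^T, 1)] is the sum of [(0, 1)] and [(-b^T, 0)]. *)
apply: (@determinant_multilinear _ _ _ _ _ (rshift n 0)).
- have rowE (A : 'M[R]_(n + 1)) i j : row i A 0 j = A i j by rewrite mxE.
  apply/rowP => j; rewrite -[j]splitK !scale1r [RHS]mxE !rowE.
  by case: (split j) => k; rewrite /= !(block_mxEdl, block_mxEdr) ?[const_mx _ _ _]mxE
    ?add0r ?addr0.
- by apply/matrixP => i j; rewrite [LHS]mxE [RHS]mxE; case: (liftE i) => k ->;
    rewrite !block_mxEv !col_mxEu.
- by apply/matrixP => i j; rewrite [LHS]mxE [RHS]mxE; case: (liftE i) => k ->;
    rewrite !block_mxEv !col_mxEu.
Qed.

(** The determinant is multiplied by that of [S^T *m S], which is one. Two sizes with an equation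
    between them allow an [S] from [r + 1] to [1 + r] columns. *)
Lemma det_bordered_orthogonal n r1 r2 (e : r1 = r2) (K : 'M[R]_n)
    (U W : 'M[R]_(n, r1)) (S : 'M_(r1, r2)) :
  S *m S^T = 1%:M -> \det (bordered K (U *m S) (W *m S)) = \det (bordered K U W).
Proof.
subst r2 => S1.
have -> : bordered K (U *m S) (W *m S) =
    block_mx 1%:M 0 0 S^T *m bordered K U W *m block_mx 1%:M 0 0 S.
  rewrite !mulmx_block !mul1mx !mulmx1 !mul0mx !mulmx0 !add0r !addr0 mul0mx.
  by rewrite mulmxN -trmx_mul.
rewrite !det_mulmx !det_ublock !det1 !mul1r mulrAC -det_mulmx.
by rewrite (mulmx1C S1) det1 mul1r.
Qed.

(** Seen in the bordered matrix, the change of [K] is a rank-one update along [col_mx b 0]. The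
    extra border that it creates is then absorbed as an additional column of [U] and [W]. *)
Lemma det_bordered_update n r (K : 'M[R]_n) (U W : 'M[R]_(n, r))
    (a : R) (b : 'cV[R]_n) :
  \det (bordered (K + a *: (b *m b^T)) U W) =
  \det (bordered K U W) + a * \det (bordered K (row_mx b U) (row_mx b W)).
Proof.
have -> : bordered (K + a *: (b *m b^T)) U W =
    bordered K U W + (a *: col_mx b 0) *m (col_mx b (0 : 'cV_r))^T.
  rewrite /bordered -scalemxAl tr_col_mx trmx0 mul_col_row !mulmx0 !mul0mx.
  by rewrite scale_block_mx !scaler0 add_block_mx !addr0.
rewrite det_rank1_update; congr (_ + _).
have -> : block_mx (bordered K U W) (a *: col_mx b 0) (- (col_mx b 0)^T) 0 =
    block_mx (bordered K U W) (col_mx b 0) (- (col_mx b 0)^T) 0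
     *m block_mx 1%:M 0 0 (a%:M : 'M_1).
  rewrite mulmx_block !mulmx1 !mulmx0 !mul0mx !addr0 !add0r.
  by rewrite mul_mx_scalar.
rewrite det_mulmx det_ublock det1 mul1r det_scalar expr1 mulrC; congr (_ * _).
(* The block permutation that moves the last column to the front. *)
pose S : 'M[R]_(r + 1, 1 + r) := block_mx 0 1%:M 1%:M 0.
have SS : S *m S^T = 1%:M.
  rewrite /S tr_block_mx !trmx0 !trmx1 mulmx_block !mulmx0 !mulmx1 !addr0 !add0r.
  by rewrite -scalar_mx_block.
have rS (Y : 'M[R]_(n, r)) : row_mx b Y = row_mx Y b *m S.
  by rewrite /S mul_row_block !mulmx0 !mulmx1 addr0 add0r.
rewrite !rS det_bordered_orthogonal ?addn1 //.
have -> : bordered K (row_mx U b) (row_mx W b) =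
    block_mx K (row_mx W b) (col_mx (- U^T) (- b^T)) (block_mx 0 0 0 0).
  by rewrite /bordered tr_row_mx opp_col_mx block_mx0.
by rewrite block_mxA det_castmx_sq tr_col_mx opp_row_mx trmx0 oppr0.
Qed.

End BorderedDeterminants.

(** * Forest expansion of the bordered Laplacian *)

Section AllMinors.

Variables (R : realFieldType) (V : finType) (g : V).
Implicit Types (u v x y : V) (C : {set V}) (s : seq {set V}) (F : {set {set V}}).

Local Notation n := #|offground g|.

(** * Vertices off the ground, indicator rows and Gram matrices *)

Lemma vertex_neq (i : 'I_n) : vertex i != g.
Proof.
have := enum_valP i; rewrite !inE; apply: contraNneq => e.
by rewrite -[X in _ == enum_rank X]e enum_valK.
Qed.

Lemma vertex_inj : injective (@vertex V g).
Proof. by move=> i j /enum_val_inj/enum_val_inj. Qed.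

Lemma vertex_surj v : v != g -> exists i : 'I_n, vertex i = v.
Proof.
move=> vg; have vo : enum_rank v \in offground g.
  by rewrite !inE (inj_eq enum_rank_inj).
by exists (enum_rank_in vo (enum_rank v)); rewrite /vertex enum_rankK_in ?enum_rankK.
Qed.

Definition indicator C : 'rV[R]_n := \row_i (vertex i \in C)%:R.

Definition edge_vector u v : 'cV[R]_n := basis_vector R g u - basis_vector R g v.

(** At [v = g] both sides vanish: [basis_vector R g g] is zero, and [g \notin C]. *)
Lemma indicator_basis C v : g \notin C ->
  indicator C *m basis_vector R g v = (v \in C)%:R%:M.
Proof.
move=> gC; apply/matrixP => i j; rewrite !ord1 !mxE mulr1n.
have [vg|vg] := eqVneq v g.
  rewrite vg (negPf gC) big1 // => k _.
  by rewrite !mxE (negPf (vertex_neq k)) mulr0.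
have [k ek] := vertex_surj vg; rewrite (bigD1 k) //= !mxE ek eqxx mulr1.
rewrite big1 ?addr0 // => k' kk'.
by rewrite !mxE -ek (inj_eq vertex_inj) (negPf kk') mulr0.
Qed.

Lemma indicator_edge C u v : g \notin C ->
  indicator C *m edge_vector u v = ((u \in C)%:R - (v \in C)%:R)%:M.
Proof.
by move=> gC; rewrite mulmxBr !indicator_basis // -raddfB.
Qed.

(** This is [Q^T Q] for the matrix [Q] whose rows are the indicators of [s]; as a sum it is visibly
    invariant under reordering of [s]. *)
Definition gram s : 'M[R]_n := \sum_(C <- s) (indicator C)^T *m indicator C.

(** The number of rows is a parameter so that it can be split as [1 + r]. It is meant to be
    [size s]; rows beyond that are zero. *)
Definition indicator_mx r s : 'M[R]_(r, n) :=
  \matrix_(a, i) (vertex i \in nth set0 s a)%:R.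

Lemma indicator_mx_cons r C s :
  indicator_mx (1 + r) (C :: s) = col_mx (indicator C) (indicator_mx r s).
Proof.
apply/matrixP => i j; rewrite -[i]splitK; case: (split i) => k /=.
  by rewrite col_mxEu (ord1 k) !mxE.
by rewrite col_mxEd !mxE.
Qed.

Lemma gramE s : gram s = (indicator_mx (size s) s)^T *m indicator_mx (size s) s.
Proof.
elim: s => [|C s IHs]; first by rewrite /gram big_nil [_^T]thinmx0 mul0mx.
rewrite /gram big_cons -/(gram s) IHs.
by rewrite -mul_row_col -tr_col_mx -indicator_mx_cons.
Qed.

Lemma det_gram r s (U W : 'M[R]_(n, r)) : size s = r ->
  \det (U^T *m gram s *m W) =
  \det (indicator_mx r s *m U) * \det (indicator_mx r s *m W).
Proof.
move=> sr; subst r; rewrite gramE mulmxA -trmx_mul -mulmxA.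
by rewrite det_mulmx det_tr.
Qed.

(* A unimodular row operation turns the row of C2 into that of C1 :|: C2. *)
Lemma det_gram_merge r C1 C2 s (U W : 'M[R]_(n, r)) :
  [disjoint C1 & C2] -> size s = r.-2 -> (1 < r)%N ->
  \det (U^T *m gram [:: C1, C2 & s] *m W) =
  \det (U^T *m gram [:: C1, C1 :|: C2 & s] *m W).
Proof.
case: r U W => [|[|r]] // U W dC sr _; rewrite !det_gram /= ?sr //.
pose T : 'M[R]_(1 + (1 + r)) := block_mx 1%:M 0 (col_mx 1%:M 0) 1%:M.
have dT : \det T = 1 by rewrite det_lblock !det1 mulr1.
have ind12 : indicator (C1 :|: C2) = indicator C1 + indicator C2.
  apply/rowP => i; rewrite !mxE inE -natrD.
  case: (boolP (vertex i \in C1)) => //= i1.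
  by rewrite (disjointFr dC i1).
have -> : indicator_mx r.+2 [:: C1, C1 :|: C2 & s] =
          T *m indicator_mx r.+2 [:: C1, C2 & s].
  rewrite !(@indicator_mx_cons r.+1) !(@indicator_mx_cons r) /T mul_block_col.
  by rewrite !mul1mx mul0mx addr0 mul_col_mx mul1mx mul0mx add_col_mx add0r ind12.
by rewrite -!mulmxA !(det_mulmx T) dT !mul1r.
Qed.

(** Since [b] is annihilated by all rows but that of [C], both factors become block triangular with
    corner [d]. The sign [d] enters once with [U] and once with [W], and cancels. *)
Lemma det_gram_cons r C s (b : 'cV[R]_n) (d : R) (U W : 'M[R]_(n, r)) :
  size s = r -> {in s, forall C', indicator C' *m b = 0} ->
  indicator C *m b = d%:M -> d * d = 1 ->
  \det ((row_mx b U)^T *m gram (C :: s) *m row_mx b W) = \det (U^T *m gram s *m W).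
Proof.
move=> sr sb Cb dd; rewrite !det_gram /= ?sr //.
have Qb : indicator_mx r s *m b = 0.
  apply/matrixP => i j; rewrite ord1.
  have := sb (nth set0 s i); rewrite mem_nth ?sr // => /(_ isT)/matrixP/(_ 0 0).
  by rewrite !mxE => {2}<-; apply: eq_bigr => k _; rewrite !mxE.
have red (Y : 'M[R]_(n, r)) :
    \det (indicator_mx r.+1 (C :: s) *m row_mx b Y) = d * \det (indicator_mx r s *m Y).
  rewrite -[r.+1]/(1 + r)%N indicator_mx_cons mul_col_row Cb Qb det_ublock.
  by rewrite det_scalar expr1.
by rewrite !red mulrACA dd mul1r.
Qed.

(** * The Gram matrix of the nonground components *)

Lemma nonground_componentsE F :
  nonground_components g F = components F :\ component F g.
Proof.
apply/setP => C; rewrite inE in_setD1 andbC.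
case: (boolP (C \in components F)) => [CF|_]; last by rewrite !andbF.
rewrite !andbT; apply/idP/idP; apply: contra; first by move/eqP->; rewrite inE connect0.
by move=> gC; rewrite (mem_component CF gC).
Qed.

Lemma card_components F : #|components F| = #|nonground_components g F|.+1.
Proof.
rewrite nonground_componentsE (cardsD1 (component F g)).
by rewrite componentsE imset_f.
Qed.

Definition comp_gram F : 'M[R]_n :=
  \sum_(C in nonground_components g F) (indicator C)^T *m indicator C.

Lemma comp_gram_seq F s :
  perm_eq s (enum (nonground_components g F)) -> comp_gram F = gram s.
Proof. by move=> ps; rewrite /gram (perm_big _ ps) /= big_enum. Qed.

Lemma component_edge0 F C u v : C \in nonground_components g F ->
  (u \in C) = (v \in C) -> indicator C *m edge_vector u v = 0.
Proof.
by rewrite inE => /andP[_ gC] e; rewrite indicator_edge // e subrr raddf0.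
Qed.

(** Every component holds both ends of the edge or neither, so the Gram matrix sends the column
    [edge_vector u v] to zero. *)
Lemma comp_gram_edge0 F r u v (U W : 'M[R]_(n, r)) : connect (adj F) u v ->
  \det ((row_mx (edge_vector u v) U)^T *m comp_gram F *m row_mx (edge_vector u v) W)
  = 0.
Proof.
move=> uv.
have gb : comp_gram F *m edge_vector u v = 0.
  rewrite mulmx_suml big1 // => C CF; rewrite -mulmxA.
  rewrite (component_edge0 CF) ?mulmx0 //.
  move: CF; rewrite inE componentsE => /andP[/imsetP[x _ ->] _]; rewrite !inE.
  by rewrite ![connect _ x _]connect_adjC (same_connect (connect_adjC F) uv).
rewrite -mulmxA mul_mx_row gb tr_row_mx mul_col_row !mulmx0.
by rewrite det_ublock det_mx11 mxE mul0r.
Qed.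

(** If [u] or [v] lies in the ground component, the component of the other has the only indicator
    that the edge vector does not kill, and removing it leaves exactly the nonground components
    after the edge is added. Otherwise [det_gram_merge] first replaces the component of [v] by the
    union, whose indicator kills the edge vector, and the component of [u] is then removed. *)
Lemma comp_gram_contract F r u v (U W : 'M[R]_(n, r)) :
  ~~ connect (adj F) u v -> #|components F| = r.+2 ->
  \det ((row_mx (edge_vector u v) U)^T *m comp_gram F *m row_mx (edge_vector u v) W)
  = \det (U^T *m comp_gram ([set u; v] |: F) *m W).
Proof.
move=> uv cF; set b := edge_vector u v.
set Cu := component F u; set Cv := component F v; set Cg := component F g.
have inF x : component F x \in components F by rewrite componentsE imset_f.
have uCu : u \in Cu by rewrite inE.
have vCv : v \in Cv by rewrite inE.
have vCu : v \notin Cu by rewrite inE.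
have uCv : u \notin Cv by rewrite inE connect_adjC.
have Cuv : Cu != Cv by rewrite component_eq.
have notin C : C \in components F -> C != Cu -> u \notin C.
  by move=> CF; apply: contra => uC; apply/eqP; apply: mem_component.
have notin' C : C \in components F -> C != Cv -> v \notin C.
  by move=> CF; apply: contra => uC; apply/eqP; apply: mem_component.
have CUn : Cu :|: Cv \notin components F.
  apply/negP => h; have := mem_component (x := u) h; rewrite inE uCu => /(_ isT).
  by move/setP/(_ v); rewrite inE vCv orbT (negPf vCu).
have cardng : #|nonground_components g F| = r.+1.
  by have := card_components F; rewrite cF => -[].
(* The components containing none of [u], [v], [g]; they survive the addition of the edge. *)
pose X := components F :\ Cu :\ Cv :\ Cg.
have XE C : (C \in X) = [&& C != Cg, C != Cv, C != Cu & C \in components F].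
  by rewrite !in_setD1.
have X0 : {in enum X, forall C, indicator C *m b = 0}.
  move=> C; rewrite mem_enum XE => /and4P[CCg CCv CCu CF].
  apply: (@component_edge0 F); first by rewrite nonground_componentsE in_setD1 CCg.
  by rewrite (negPf (notin _ CF CCu)) (negPf (notin' _ CF CCv)).
have ngE C : (C \in nonground_components g F) = (C != Cg) && (C \in components F).
  by rewrite nonground_componentsE in_setD1.
have ngE' C : (C \in nonground_components g ([set u; v] |: F)) =
    (C == Cu :|: Cv) && (g \notin C) || (C \in X).
  rewrite inE componentsU1 // in_setU1 andb_orl; congr (_ || _).
  rewrite XE !in_setD1; case: (boolP (C \in components F)) => CF; last by rewrite !andbF.
  have := ngE C; rewrite inE CF /= !andbT => ->.
  by rewrite andbC.
have permX s (A : {set {set V}}) : uniq s -> s =i A -> perm_eq s (enum A).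
  by move=> us sA; apply: uniq_perm; rewrite ?enum_uniq // => C; rewrite mem_enum sA.
have uX s : uniq s -> {in s, forall C, C \notin X} -> uniq (s ++ enum X).
  move=> us sX; rewrite cat_uniq us enum_uniq andbT /=; apply/hasPn => C /=.
  by rewrite mem_enum; apply: contraL => /sX.
have CuX : Cu \notin X by rewrite XE eqxx !andbF.
have CvX : Cv \notin X by rewrite XE eqxx !andbF.
(* Here [C2] is the ground component and [C1] the component at the other end; an unordered pair
   serves both orientations of the edge. *)
have ground_edge C1 C2 d : [set C1; C2] = [set Cu; Cv] -> C1 != C2 -> C2 = Cg ->
    indicator C1 *m b = d%:M -> d * d = 1 ->
    \det ((row_mx b U)^T *m comp_gram F *m row_mx b W)
    = \det (U^T *m comp_gram ([set u; v] |: F) *m W).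
  move=> /setP e12 C12 e2 C1b dd.
  have C1F : C1 \in components F.
    by have := e12 C1; rewrite !inE eqxx /= => /esym/orP[]/eqP->; apply: inF.
  have gUv : g \in Cu :|: Cv.
    have gC2 : g \in C2 by rewrite e2 inE connect0.
    have [e|e] : C2 = Cu \/ C2 = Cv.
      by have := e12 C2; rewrite !inE eqxx orbT => /esym/orP[]/eqP; auto.
    by rewrite in_setU -e gC2.
    by rewrite in_setU -e gC2 orbT.
  have XE' C : (C \in X) = [&& C != C1, C != C2 & C \in components F].
    have := e12 C; rewrite XE -e2 !inE.
    by case: (C == C1); case: (C == C2); case: (C == Cu); case: (C == Cv).
  have pF : perm_eq (C1 :: enum X) (enum (nonground_components g F)).
    apply: permX; first by rewrite /= mem_enum XE' eqxx enum_uniq.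
    move=> C; rewrite inE mem_enum XE' ngE -e2; case: (eqVneq C C1) => //= ->.
    by rewrite C12.
  have pG : perm_eq (enum X) (enum (nonground_components g ([set u; v] |: F))).
    by apply: permX; rewrite ?enum_uniq // => C;
      rewrite mem_enum ngE'; case: eqVneq => // ->; rewrite gUv.
  rewrite (comp_gram_seq pF) (comp_gram_seq pG); apply: det_gram_cons C1b dd => //.
  by have := perm_size pF; rewrite -cardE cardng => -[].
have bu : g \notin Cu -> indicator Cu *m b = 1%:M.
  by move=> gCu; rewrite indicator_edge // uCu (negPf vCu) subr0.
have bv : g \notin Cv -> indicator Cv *m b = (-1)%:M.
  by move=> gCv; rewrite indicator_edge // vCv (negPf uCv) sub0r.
have CgE x : g \in component F x -> component F x = Cg by apply: mem_component.
have [/CgE gCu|gCu] := boolP (g \in Cu).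
  have gCv : g \notin Cv by apply: contra Cuv => /CgE gv; apply/eqP; apply: etrans gCu (esym gv).
  apply: (ground_edge Cv Cu _ _ _ gCu (bv gCv)); rewrite ?mulrNN ?mulr1 //.
    by rewrite setUC.
  by rewrite eq_sym.
have [/CgE gCv|gCv] := boolP (g \in Cv).
  by apply: (ground_edge Cu Cv _ _ _ gCv (bu gCu)); rewrite ?mulr1.
have CuCg : Cu != Cg by apply: contraNneq gCu => ->; rewrite inE connect0.
have CvCg : Cv != Cg by apply: contraNneq gCv => ->; rewrite inE connect0.
have UX : Cu :|: Cv \notin X by rewrite XE (negPf CUn) !andbF.
have pF : perm_eq [:: Cu, Cv & enum X] (enum (nonground_components g F)).
  apply: permX.
    apply: (uX [:: Cu; Cv]) => [|C]; first by rewrite /= in_cons in_nil orbF Cuv.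
    by rewrite 2!in_cons in_nil orbF => /orP[]/eqP->.
  move=> C; rewrite !in_cons mem_enum XE ngE.
  case: (eqVneq C Cu) => [->|_]; first by rewrite CuCg inF.
  by case: (eqVneq C Cv) => [->|_] //=; rewrite CvCg inF.
have pG : perm_eq (Cu :|: Cv :: enum X)
    (enum (nonground_components g ([set u; v] |: F))).
  apply: permX; first by apply: (uX [:: Cu :|: Cv]) => // C; rewrite in_cons in_nil orbF => /eqP->.
  move=> C; rewrite in_cons mem_enum ngE'; case: (eqVneq C (Cu :|: Cv)) => //= ->.
  by rewrite in_setU (negPf gCu) (negPf gCv).
(* Two of the [r.+1] nonground components are outside [X]. In particular [r] is positive, as merging
   two rows requires. *)
have sX : r = (size (enum X)).+1.
  by have := esym (perm_size pF); rewrite -[LHS]cardE cardng => -[].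
rewrite (comp_gram_seq pF) (comp_gram_seq pG) (@det_gram_merge r.+1); first last.
- by rewrite sX.
- by rewrite sX.
- rewrite disjoint_subset; apply/subsetP => x; rewrite !inE => ux.
  by rewrite connect_adjC -(same_connect (connect_adjC F) ux) -/(v \in Cu).
apply: det_gram_cons (bu gCu) _; rewrite ?mulr1 //= => C.
rewrite in_cons => /orP[/eqP->|/X0 //].
rewrite indicator_edge; last by rewrite in_setU negb_or gCu gCv.
by rewrite !in_setU uCu vCv orbT subrr raddf0.
Qed.

(** * Laplacian and weights under adding an edge *)

Lemma laplacian_entryU1 (E : {set {set V}}) (c : {set V} -> R) u v x y :
  u != v -> [set u; v] \notin E ->
  laplacian_entry ([set u; v] |: E) c x y = laplacian_entry E c x y +
    c [set u; v] * (((x == u)%:R - (x == v)%:R) * ((y == u)%:R - (y == v)%:R)).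
Proof.
move=> uv eE; rewrite /laplacian_entry.
case: (eqVneq x y) => [<-|xy].
  rewrite [LHS]big_mkcondr big_setU1 //= -big_mkcondr addrC.
  congr (_ + _); rewrite in_set2.
  case: (eqVneq x u) => [->|xu]; first by rewrite (negPf uv) subr0 !mulr1.
  by case: (x == v); rewrite ?sub0r ?mulrNN ?subrr ?mulr0 ?mulr1.
rewrite in_setU1.
have [/set2_eq[[xu yv]|[xv yu]]|ne] := eqVneq [set x; y] [set u; v].
- rewrite xu yv (negPf eE) /= !eqxx [v == u]eq_sym (negPf uv).
  by rewrite subr0 sub0r mul1r mulrN1 add0r.
- rewrite xv yu [[set v; u]]setUC (negPf eE) /= !eqxx [v == u]eq_sym (negPf uv).
  by rewrite subr0 sub0r mulr1 mulrN1 add0r.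
rewrite /=.
suff -> : ((x == u)%:R - (x == v)%:R) * ((y == u)%:R - (y == v)%:R) = 0 :> R.
  by rewrite mulr0 addr0.
case: (eqVneq x u) (eqVneq y v) => [xu|xu] [yv|yv].
- by rewrite xu yv eqxx in ne.
- rewrite -xu [y == x]eq_sym (negPf xy); last by rewrite subrr mulr0.
- case: (eqVneq x v) => [xv|]; first by rewrite xv yv eqxx in xy.
  by rewrite subrr mul0r.
case: (eqVneq x v) (eqVneq y u) => [xv|xv] [yu|yu]; rewrite ?subrr ?mulr0 ?mul0r //.
by rewrite xv yu setUC eqxx in ne.
Qed.

(** The rank-one form also covers an edge at [g]: the basis vector of [g] is zero, in accordance
    with the deleted row and column. *)
Lemma groundedK_U1 (E : {set {set V}}) (c : {set V} -> R) u v :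
  u != v -> [set u; v] \notin E ->
  groundedK ([set u; v] |: E) c g =
  groundedK E c g + c [set u; v] *: (edge_vector u v *m (edge_vector u v)^T).
Proof.
move=> uv eE; apply/matrixP => i j; rewrite !mxE big_ord1 !mxE.
by rewrite laplacian_entryU1.
Qed.

Lemma weightU1 (c : {set V} -> R) (e : {set V}) F :
  e \notin F -> weight c (e |: F) = c e * weight c F.
Proof. by move=> eF; rewrite /weight big_setU1. Qed.

(** * The edgeless graph *)

Lemma connect_set0 x y : connect (adj set0) x y = (x == y).
Proof.
apply/idP/eqP => [/connectP[[|z p] /=]|->]; first by move=> _ ->.
  by rewrite /adj inE.
exact: connect0.
Qed.

Lemma component_set0 x : component set0 x = [set x].
Proof. by apply/setP => y; rewrite !inE connect_set0 eq_sym. Qed.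

Lemma acyclic_set0 : acyclic (set0 : {set {set V}}).
Proof.
apply/acyclicP => -[|x [|y s]] // _ _.
by rewrite /= {1}/adj inE.
Qed.

Lemma forests_set0 m :
  forests (set0 : {set {set V}}) m = if m == #|V| then [set set0] else set0.
Proof.
apply/setP => F; rewrite inE /spanning_forest subset0.
case: (eqVneq F set0) => [->|F0]; last by case: ifP; rewrite !inE ?(negPf F0).
rewrite acyclic_set0 /= componentsE.
have -> : [set component set0 x | x in V] = [set [set x] | x in V].
  by apply: eq_imset => x; rewrite component_set0.
rewrite card_imset; last exact: set1_inj.
by rewrite eq_sym; case: ifP; rewrite !inE ?eqxx.
Qed.

Lemma card_offground : #|V| = n.+1.
Proof. by rewrite cardsC1 card_ord prednK // (cardD1 g). Qed.

(** Without edges the nonground components are singletons, and their indicators form the standard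
    basis. *)
Lemma comp_gram_set0 : comp_gram set0 = 1%:M.
Proof.
rewrite /comp_gram.
have -> : nonground_components g set0 = [set [set x] | x in [set~ g]].
  apply/setP => C; rewrite inE componentsE; apply/andP/imsetP.
    case=> /imsetP[x _ ->]; rewrite component_set0 in_set1 => gx.
    by exists x; rewrite // !inE eq_sym.
  case=> x xg ->; rewrite in_set1 eq_sym; rewrite !inE in xg; split=> //.
  by apply/imsetP; exists x; rewrite ?component_set0.
rewrite big_imset /=; last by move=> x y _ _; apply: set1_inj.
apply/matrixP => i j; rewrite summxE (bigD1 (vertex i)) /=; last first.
  by rewrite !inE vertex_neq.
rewrite big1 => [|x /andP[_ xi]].
  rewrite addr0 !mxE big_ord1 !mxE !inE eqxx mul1r (inj_eq vertex_inj).
  by rewrite eq_sym.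
by rewrite !mxE big_ord1 !mxE !inE eq_sym (negPf xi) mul0r.
Qed.

(** * The forest expansion, by induction on the number of edges *)

Lemma card_componentsU1 F u v : ~~ connect (adj F) u v ->
  #|components F| = #|components ([set u; v] |: F)|.+1.
Proof.
move=> uv; rewrite componentsU1 // cardsU1.
have inF x : component F x \in components F by rewrite componentsE imset_f.
rewrite (cardsD1 (component F u)) inF (cardsD1 (component F v)).
rewrite [component F v \in _]in_setD1 inF eq_sym component_eq uv andbT /= !add1n.
suff -> : component F u :|: component F v \notin
  components F :\ component F u :\ component F v by [].
apply/negP; rewrite !in_setD1 => /and3P[_ _ h].
have := mem_component (x := u) h; rewrite !inE connect0 => /(_ isT)/setP/(_ v).
by rewrite !inE connect0 orbT (negPf uv).
Qed.

(** The induction keeps [r], [U] and [W] general, since removing an edge produces a second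
    determinant whose borders have one more column. *)
Lemma det_bordered_forests (E : {set {set V}}) (c : {set V} -> R) r
    (U W : 'M[R]_(n, r)) : simple_graph E ->
  \det (bordered (groundedK E c g) U W) =
  \sum_(F in forests E r.+1) \det (U^T *m comp_gram F *m W) * weight c F.
Proof.
elim: {E}#|E| {-2}E (erefl #|E|) r U W => [|k IHk] E Ek r U W hE.
  move/eqP: Ek; rewrite cards_eq0 => /eqP->.
  have -> : groundedK set0 c g = 0.
    apply/matrixP => i j; rewrite !mxE /laplacian_entry inE big1 ?if_same // => e.
    by rewrite inE.
  (* The only forest is empty and has [#|V|], that is [n.+1], components; so either [r = n] or both
     sides are zero. *)
  rewrite forests_set0; have -> : (r.+1 == #|V|) = (r == n).
    by rewrite -[RHS]eqSS -card_offground.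
  case: eqVneq => [rn|rn]; last by rewrite big_set0 det_bordered0_neq.
  subst r; rewrite big_set1 comp_gram_set0 mulmx1 /weight big_set0 mulr1.
  exact: det_bordered0_square.
have [e eE] : exists e, e \in E by apply/set0Pn; rewrite -card_gt0 Ek.
have /eqP := hE e eE; case/cards2P => u [v [uv ee]].
pose E' := E :\ e; have eE' : e \notin E' by rewrite !inE eqxx.
have EE' : E = e |: E' by rewrite setD1K.
have E'k : #|E'| = k by move: Ek; rewrite (cardsD1 e) eE => -[].
have hE' : simple_graph E' by move=> f; rewrite inE => /andP[_ /hE].
rewrite {1}EE' ee groundedK_U1 -?ee // det_bordered_update !IHk //.
(* Forests avoiding [e] are the forests of [E']; they give the first determinant. *)
rewrite [RHS](bigID (fun F => e \notin F)) /=; congr (_ + _).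
  apply: eq_bigl => F; rewrite !inE /spanning_forest subsetD1.
  by case: (F \subset E); case: (e \in F); rewrite /= ?andbT ?andbF.
rewrite [RHS](reindex_onto (fun F => e |: F) (fun F => F :\ e)) /=; last first.
  by move=> F /andP[_]; rewrite negbK => /setD1K.
rewrite mulr_sumr (bigID (fun F => connect (adj F) u v)) /= big1 ?add0r; last first.
  by move=> F /andP[_ uvF]; rewrite comp_gram_edge0 // mul0r mulr0.
(* Adding [e] lowers the number of components from [r.+2] to [r.+1]. The conjunct
   [(e |: F) :\ e == F], produced by the reindexing, says that [e] is not in [F]. *)
have forestU1 F : (F \in forests E' r.+2) && ~~ connect (adj F) u v =
    [&& e |: F \in forests E r.+1, ~~ (e \notin e |: F) & (e |: F) :\ e == F].
  rewrite !inE negbK eqxx /= /spanning_forest subUset sub1set eE /= subsetD1.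
  apply/idP/idP.
    case/andP=> /andP[/andP[/andP[-> eF] aF] cF] nuv.
    by rewrite setU1K // eqxx andbT ee acyclicU1 //= -eqSS -card_componentsU1.
  case/andP=> /andP[/andP[FE aF] cF] /eqP eK.
  have eF : e \notin F by rewrite -eK !inE eqxx.
  have nuv : ~~ connect (adj F) u v by apply: acyclicU1_connect; rewrite -?ee.
  rewrite FE eF nuv (acyclic_sub _ aF) ?subsetUr //= andbT.
  by rewrite (card_componentsU1 nuv) -ee eqSS.
apply: eq_big => [F|F]; rewrite ?forestU1 ?andbA //.
rewrite -!andbA -forestU1.
case/andP; rewrite inE => /andP[/andP[FE _] /eqP cF] nuv.
have eF : e \notin F by move: FE; rewrite subsetD1 => /andP[].
by rewrite comp_gram_contract // weightU1 // ee mulrCA.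
Qed.

(** * Spanning trees and the matrix-tree theorem *)

Lemma connectedE F : connected F = (#|components F| == 1%N).
Proof.
apply/forallP/cards1P => [h|[C eC] u].
  exists (component F g); apply/eqP; rewrite eqEsubset sub1set componentsE imset_f //.
  rewrite andbT; apply/subsetP => C /imsetP[x _ ->].
  by rewrite in_set1 component_eq; have /forallP := h x.
apply/forallP => v; rewrite -component_eq.
have inC x : component F x = C.
  by apply/set1P; rewrite -eC componentsE imset_f.
by rewrite !inC.
Qed.

(** The forest expansion for borders without columns: forests with one component are the spanning
    trees, and empty determinants are one. *)
Lemma det_groundedK (E : {set {set V}}) (c : {set V} -> R) :
  simple_graph E -> \det (groundedK E c g) = tau E c.
Proof.
move=> hE; rewrite -(det_bordered_nocol (groundedK E c g) 0 0).
rewrite det_bordered_forests // /tau; apply: eq_big => [F|F _].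
  by rewrite inE /spanning_forest /spanning_tree connectedE -andbA.
by rewrite det_mx00 mul1r.
Qed.

(** All summands are positive, so one spanning tree suffices. A maximal spanning forest is one,
    since an edge of [E] joining two of its components could still be added. *)
Lemma tau_gt0 (E : {set {set V}}) (c : {set V} -> R) :
  simple_graph E -> connected E -> {in E, forall e, 0 < c e} -> 0 < tau E c.
Proof.
move=> hE hconn hc.
have wgt F : F \subset E -> 0 < weight c F.
  by move=> /subsetP FE; apply: prodr_gt0 => e /FE; apply: hc.
have [|T maxT _] := @maxset_exists _ (spanning_forest E) set0.
  by rewrite /spanning_forest sub0set acyclic_set0.
have /andP[TE aT] := maxsetp maxT.
have treeT : spanning_tree E T.
  rewrite /spanning_tree TE aT; apply/forallP => x; apply/forallP => y.
  have /forallP/(_ y) := forallP hconn x; apply: connect_sub => u v uv.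
  apply/negPn/negP => nuv.
  have FT : spanning_forest E ([set u; v] |: T).
    by rewrite /spanning_forest subUset sub1set [_ \in E]uv TE acyclicU1.
  have eT := maxsetsup maxT FT (subsetUr _ _).
  by move/negP: nuv; apply; apply: connect1; rewrite /adj -eT !inE eqxx.
rewrite /tau (bigD1 T) //=; apply: ltr_pwDl; first exact: wgt.
by apply: sumr_ge0 => F /andP[/and3P[FE _ _] _]; apply/ltW/wgt.
Qed.

(** * Passage to the minors of [Zmx] *)

Lemma sqdet_square m (A : 'M[R]_m) : sqdet A = \det A.
Proof. by rewrite /sqdet conform_mx_id. Qed.

Lemma sqdet_gram m s (U W : 'M[R]_(n, m)) : size s = m ->
  sqdet (Qmx R g s *m U) * sqdet (Qmx R g s *m W) = \det (U^T *m gram s *m W).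
Proof. by move=> sm; subst m; rewrite !sqdet_square det_gram. Qed.

(** As [tau] is the nonzero determinant of [K], the bordered determinant is [tau] times the
    left-hand side. The sizes [m1] and [m2] are kept apart because in use they are cardinals that
    equal [r] only propositionally. *)
Lemma sqdet_minor_forests (E : {set {set V}}) (c : {set V} -> R)
    (C : {set {set V}} -> seq {set V}) r m1 m2
    (U : 'M[R]_(n, m1)) (W : 'M[R]_(n, m2)) :
  simple_graph E -> connected E -> {in E, forall e, 0 < c e} ->
  (forall F, spanning_forest E F -> perm_eq (C F) (enum (nonground_components g F))) ->
  m1 = r -> m2 = r ->
  sqdet (U^T *m invmx (groundedK E c g) *m W) =
  (tau E c)^-1 * \sum_(F in forests E r.+1)
    sqdet (Qmx R g (C F) *m U) * sqdet (Qmx R g (C F) *m W) * weight c F.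
Proof.
move=> hE hconn hc hC e1 e2; subst m1 m2; rewrite sqdet_square.
have tau0 : tau E c != 0 by rewrite gt_eqF ?tau_gt0.
have uK : groundedK E c g \in unitmx by rewrite unitmxE det_groundedK // unitfE.
apply: (mulfI tau0); rewrite mulVKf // -{1}(det_groundedK c hE).
rewrite -det_bordered_unit // det_bordered_forests //; apply: eq_bigr => F.
rewrite inE => /andP[fF /eqP cF]; congr (_ * _).
rewrite sqdet_gram -?(comp_gram_seq (hC F fF)) //.
rewrite (perm_size (hC F fF)) -cardE.
by have := card_components F; rewrite cF => -[].
Qed.

(** Since [xs] lists [B] without repetition, [tnth xs] maps the positions bijectively onto [A]. *)
Lemma card_positions q (xs : q.-tuple V) (A B : {set V}) :
  perm_eq xs (enum B) -> A \subset B -> #|positions xs A| = #|A|.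
Proof.
move=> pxs /subsetP AB.
have uxs : uniq xs by rewrite (perm_uniq pxs) enum_uniq.
have im : [set tnth xs j | j in positions xs A] = A.
  apply/setP => x; apply/imsetP/idP => [[j]|xA]; first by rewrite inE => jA ->.
  have : x \in xs by rewrite (perm_mem pxs) mem_enum AB.
  by case/tnthP => j ej; exists j; rewrite // inE -ej.
by rewrite -[in RHS]im card_imset //; apply/tuple_uniqP.
Qed.

End AllMinors.

Theorem theorem4p2 (R : realFieldType) (V : finType)
    (E : {set {set V}}) (hE : simple_graph E) (hconn : connected E)
    (c : {set V} -> R) (hc : {in E, forall e, 0 < c e})
    (M : {set V}) (hM : M != set0)
    (P : {set {set V}}) (hP : partition P M)
    (rt : {set V} -> V) (hrt : {in P, forall X, rt X \in X})
    (q : nat) (xs : q.-tuple V) (hxs : perm_eq xs (enum (M :\: superport_roots P rt)))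
    (g : V) (hg : g \in superport_roots P rt)
    (C : {set {set V}} -> seq {set V})
    (hC : forall F, spanning_forest E F ->
            perm_eq (C F) (enum (nonground_components g F)))
    (r : nat) (A B : {set V})
    (hA : A \subset M :\: superport_roots P rt) (hB : B \subset M :\: superport_roots P rt)
    (hAr : #|A| = r) (hBr : #|B| = r) :
  sqdet (subsetmx (Zmx E c g P rt xs) (positions xs A) (positions xs B))
  = (tau E c)^-1 *
    \sum_(F in forests E r.+1)
      chi R g P rt xs (C F) A * chi R g P rt xs (C F) B * weight c F.
Proof.
pose sub S : 'M[R]_(_, #|positions xs S|) :=
  colsub (fun j => enum_val j) (Dmx R g P rt xs).
have cA : #|positions xs A| = r by rewrite (card_positions hxs).
have cB : #|positions xs B| = r by rewrite (card_positions hxs).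
(* Selecting rows and columns of [Zmx] amounts to selecting columns of [Dmx] on either side, which
   turns the minor into the form with arbitrary [U] and [W]. *)
have -> : subsetmx (Zmx E c g P rt xs) (positions xs A) (positions xs B) =
    (sub A)^T *m invmx (groundedK E c g) *m sub B.
  by rewrite /subsetmx /Zmx mxsub_mul /sub trmx_mxsub -mul_rowsub_mx.
rewrite (sqdet_minor_forests _ _ hE hconn hc hC cA cB); congr (_ * _).
by apply: eq_bigr => F _; rewrite /chi /Bmx !mulmx_colsub.
Qed.
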